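(* Let $n$ and $k$ be integers with $0\le k\le n-2$, and suppose that $\frac{k}{n}=\frac{l}{l+1}$ for some integer $l\geq 0$. Then the action of the dihedral group $D_{2n}$ on the elements $\alpha_i$ ($i\in\mathbb{Z}$) of $H_{2l}(\mathcal{N}(n,k))$ is given by \[g\alpha_i=\alpha_{i+1},\qquad \varepsilon\alpha_i=(-1)^{l+1}\alpha_{-i-1}.\]
   Context: All homology has integer coefficients. For integers $i\le j$, $[i,j]_n$ is the image of $\{i,\dots,j\}$ under $\mathbb{Z}\to\mathbb{Z}/n$, and $\mathcal{N}(n,k)$ is the simplicial complex with vertex set $\{0,\dots,n-1\}$ (identified with $\mathbb{Z}/n$) whose maximal simplices are the sets $[i,i+k]_n$, $i=0,\dots,n-1$. The dihedral group $D_{2n}=\langle g,\varepsilon\mid g^n=1,\ \varepsilon^2=1,\ \varepsilon g\varepsilon=g^{-1}\rangle$ acts on $\mathcal{N}(n,k)$ through its action on vertices $g(i)=(i+1)\bmod n$, $\varepsilon(i)=-i\bmod n$, and hence acts on homology. When $\frac{k}{n}=\frac{l}{l+1}$ (so $l(n-k)=k$ and $(l+1)(n-k)=n$), let $\Delta$ be the oriented $(2l+1)$-simplex \[\Delta=[0,1,\,n-k,\,n-k+1,\,2(n-k),\,2(n-k)+1,\dots,l(n-k),\,l(n-k)+1].\] It is a minimal non-face of $\mathcal{N}(n,k)$, so its boundary $\partial\Delta=\sum_{i=0}^l\bigl(\Delta\setminus\{i(n-k)\}-\Delta\setminus\{i(n-k)+1\}\bigr)$ is a $2l$-cycle in $\mathcal{N}(n,k)$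 (here $\Delta\setminus\{v\}$ is the oriented simplex obtained by deleting $v$ from the ordered list). For $i\in\mathbb{Z}$ let $\alpha_i=[g^i(\partial\Delta)]\in H_{2l}(\mathcal{N}(n,k))$; one has $\alpha_i=\alpha_{i\bmod (n-k)}$. *)

(* Defs.v *)
From HB Require Import structures.
Set Warnings "-notation-overridden,-ambiguous-paths".
Set Warnings "-redundant-canonical-projection,-projection-no-head-constant".
From mathcomp Require Import all_boot all_order all_algebra all_fingroup.
From mathcomp Require Import all_solvable boolp zify.

Set Implicit Arguments.
Unset Strict Implicit.
Unset Printing Implicit Defensive.

Import Order.TTheory GRing.Theory Num.Theory.
Local Open Scope ring_scope.
Local Open Scope quotient_scope.

Record complex (V : finType) := Complex {
  faces :> {set {set V}};
  faces_sub : forall A B : {set V}, B \in faces -> A \subset B -> A \in faces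
}.

Definition simplicial (V W : finType) (K : complex V) (L : complex W)
  (f : V -> W) := forall A : {set V}, A \in K -> f @: A \in L.

Section Chains.
Variable V : finType.

(* An oriented p-chain is encoded by its coefficients on all ordered simplices *)
(* [v_0, ..., v_p]. These are alternating because                              *)
(* [v_u(0), ..., v_u(p)] = (-1)^u [v_0, ..., v_p] for every permutation u.     *)
Definition coefs (p : nat) := {ffun p.+1.-tuple V -> int}.

Definition perm_tuple p (t : p.+1.-tuple V) (s : 'S_p.+1) : p.+1.-tuple V :=
  [tuple tnth t (s i) | i < p.+1].
Arguments perm_tuple : simpl never.

Definition chains (K : complex V) p : {pred coefs p} := fun c =>
  [forall t : p.+1.-tuple V,
     (c t != 0) ==> uniq t && ([set x in t] \in K)] &&
  [forall t : p.+1.-tuple V, forall s : 'S_p.+1,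
     c (perm_tuple t s) == (-1) ^+ s * c t].

(* The oriented simplex [s_0, ..., s_p]: coefficient (-1)^u on its reordering  *)
(* by u, and 0 on the other tuples.                                            *)
Definition osimplex p (s : seq V) : coefs p :=
  [ffun t : p.+1.-tuple V =>
     \sum_(u : 'S_p.+1 | tval (perm_tuple t u) == s) (-1) ^+ u].

(* On oriented simplices this is the usual alternating sum, see bd_osimplex. *)
Definition bd p (c : coefs p.+1) : coefs p :=
  [ffun t : p.+1.-tuple V => \sum_(v : V) c [tuple of v :: t]].

(* Homology is not reduced: every 0-chain is a cycle. *)
Definition cycles (K : complex V) p : {pred coefs p} := fun c =>
  chains K c && (match p return coefs p -> bool with
                 | 0%N => fun=> true
                 | _.+1 => fun c' => bd c' == 0
                 end c).

End Chains.

Definition push (V W : finType) (f : V -> W) p (c : coefs V p) : coefs W p :=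
  [ffun t : p.+1.-tuple W => \sum_(s : p.+1.-tuple V | map_tuple f s == t) c s].

Section ChainTheory.
Variables (V : finType) (K : complex V).

Lemma chainsP p (c : coefs V p) :
  reflect ((forall t, c t != 0 -> uniq t /\ [set x in t] \in K) /\
           (forall t s, c (perm_tuple t s) = (-1) ^+ s * c t))
          (c \in chains K (p:=p)).
Proof.
apply: (iffP andP) => -[H1 H2]; split.
- by move=> t ct; have /forallP/(_ t)/implyP/(_ ct)/andP[] := H1.
- by move=> t s; have /forallP/(_ t)/forallP/(_ s)/eqP := H2.
- by apply/forallP => t; apply/implyP => /H1[-> ->].
- by apply/forallP => t; apply/forallP => s; rewrite H2.
Qed.

Lemma chains_closed p : zmod_closed (chains K (p:=p)).
Proof.
split=> [|a b /chainsP[a1 a2] /chainsP[b1 b2]]; apply/chainsP; split.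
- by move=> t; rewrite ffunE eqxx.
- by move=> t s; rewrite !ffunE mulr0.
- move=> t; rewrite !ffunE => ab.
  have [a0|/a1//] := eqVneq (a t) 0.
  by apply: b1; apply: contraNneq ab => ->; rewrite a0 subr0.
- by move=> t s; rewrite !ffunE a2 b2 mulrBr.
Qed.

HB.instance Definition _ p :=
  GRing.isZmodClosed.Build (coefs V p) (chains K (p:=p)) (chains_closed p).

Lemma bdB p : {morph @bd V p : a b / a - b}.
Proof.
move=> a b; apply/ffunP => t; rewrite !ffunE -sumrB.
by apply: eq_bigr => v _; rewrite !ffunE.
Qed.

Lemma cycles_closed p : zmod_closed (cycles K (p:=p)).
Proof.
have b0 q : @bd V q 0 = 0 by rewrite -(subrr 0) bdB subrr.
split=> [|a b /andP[a1 a2] /andP[b1 b2]]; apply/andP; split.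
- exact: rpred0.
- by case: p => //= p; rewrite b0.
- exact: rpredB.
- case: p a b {a1 b1} a2 b2 => //= p a b /eqP a0 /eqP b00.
  by rewrite bdB a0 b00 subrr.
Qed.

HB.instance Definition _ p :=
  GRing.isZmodClosed.Build (coefs V p) (cycles K (p:=p)) (cycles_closed p).

Lemma perm_tupleM p (t : p.+1.-tuple V) (a b : 'S_p.+1) :
  perm_tuple (perm_tuple t a) b = perm_tuple t (b * a)%g.
Proof. by apply: eq_from_tnth => i; rewrite !tnth_mktuple permM. Qed.

Lemma perm_tuple1 p (t : p.+1.-tuple V) : perm_tuple t 1%g = t.
Proof. by apply: eq_from_tnth => i; rewrite !tnth_mktuple perm1. Qed.

Lemma perm_tupleK p (s : 'S_p.+1) :
  cancel (fun t : p.+1.-tuple V => perm_tuple t s)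
         (fun t => perm_tuple t s^-1%g).
Proof. by move=> t; rewrite perm_tupleM mulVg perm_tuple1. Qed.

Lemma perm_tupleVK p (s : 'S_p.+1) :
  cancel (fun t : p.+1.-tuple V => perm_tuple t s^-1%g)
         (fun t => perm_tuple t s).
Proof. by move=> t; rewrite perm_tupleM mulgV perm_tuple1. Qed.

Lemma perm_perm_tuple p (t : p.+1.-tuple V) (s : 'S_p.+1) :
  perm_eq (perm_tuple t s) t.
Proof. by apply/tuple_permP; exists s. Qed.

Lemma sign_perm p (s : 'S_p.+1) : (-1) ^+ s * (-1) ^+ s = 1 :> int.
Proof. by rewrite -expr2 sqrr_sign. Qed.

Lemma osimplex_alt p (s : seq V) (t : p.+1.-tuple V) (u : 'S_p.+1) :
  osimplex p s (perm_tuple t u) = (-1) ^+ u * osimplex p s t.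
Proof.
rewrite !ffunE (reindex_inj (mulIg u^-1%g)) mulr_sumr.
apply: eq_big => [w|w _]; first by rewrite perm_tupleM mulgKV.
by rewrite odd_permM odd_permV signr_addb mulrC.
Qed.

Lemma osimplex_chain p (s : seq V) :
  uniq s -> [set x in s] \in K -> osimplex p s \in chains K (p:=p).
Proof.
move=> su sK; apply/chainsP; split; last by exact: osimplex_alt.
move=> t; rewrite ffunE.
have [u /eqP us|no] := pickP (fun u : 'S_p.+1 => tval (perm_tuple t u) == s).
  have ts : perm_eq t s by rewrite -us perm_sym perm_perm_tuple.
  rewrite (perm_uniq ts) su; split=> //.
  suff -> : [set x in t] = [set x in s] by [].
  by apply/setP => x; rewrite !inE (perm_mem ts).
by rewrite big_pred0 ?eqxx.
Qed.

Lemma bd_alt p (c : coefs V p.+1) :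
  (forall t s, c (perm_tuple t s) = (-1) ^+ s * c t) ->
  forall t s, bd c (perm_tuple t s) = (-1) ^+ s * bd c t.
Proof.
move=> cA t s; rewrite !ffunE mulr_sumr; apply: eq_bigr => v _.
have -> : [tuple of v :: perm_tuple t s]
        = perm_tuple [tuple of v :: t] (lift_perm ord0 ord0 s).
  apply: eq_from_tnth => i; rewrite tnth_mktuple.
  have [j ->|->] := unliftP ord0 i; last by rewrite lift_perm_id !tnth0.
  by rewrite lift_perm_lift !tnthS tnth_mktuple.
by rewrite cA odd_lift_perm.
Qed.

Lemma bd_bd p (c : coefs V p.+2) :
  (forall t s, c (perm_tuple t s) = (-1) ^+ s * c t) -> bd (bd c) = 0.
Proof.
move=> cA; apply/ffunP => t; rewrite [LHS]ffunE [RHS]ffunE.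
under eq_bigr do rewrite ffunE.
set S := LHS; suff: S = - S by move=> SE; apply/eqP; lia.
rewrite {1}/S exchange_big /= -sumrN; apply: eq_bigr => u _.
rewrite -sumrN; apply: eq_bigr => v _.
pose w : 'S_p.+3 := tperm ord0 (lift ord0 ord0).
have -> : [tuple of u :: [tuple of v :: t]]
        = perm_tuple [tuple of v :: [tuple of u :: t]] w.
  apply: eq_from_tnth => i; rewrite tnth_mktuple /w.
  case: tpermP => [->|->|/eqP i0 /eqP i1]; rewrite ?tnthS ?tnth0 ?tnthS ?tnth0//.
  have [j ij|/eqP] := unliftP ord0 i; last by rewrite (negPf i0).
  rewrite ij !tnthS in i1 *.
  have [k ->|j0] := unliftP ord0 j; first by rewrite !tnthS.
  by rewrite j0 eqxx in i1.
by rewrite cA odd_tperm mulN1r.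
Qed.

Lemma bd_cycle p (c : coefs V p.+1) :
  (forall t s, c (perm_tuple t s) = (-1) ^+ s * c t) ->
  bd c \in chains K (p:=p) -> bd c \in cycles K (p:=p).
Proof.
move=> cA cK; apply/andP; split=> //.
by case: p c cA {cK} => // p c cA; rewrite bd_bd.
Qed.

Lemma bd_osimplex p (x0 : V) (s : seq V) : uniq s -> size s = p.+2 ->
  bd (osimplex p.+1 s)
  = \sum_(i < p.+2) osimplex p (rem (nth x0 s i) s) *~ (-1) ^+ i.
Proof.
move=> su ss; apply/ffunP => t; rewrite ffunE sum_ffunE.
under eq_bigr do rewrite ffunE big_mkcond.
rewrite exchange_big /=.
transitivity (\sum_(w : 'S_p.+2) \sum_(i < p.+2 | w i == ord0)
   \sum_(v | tval (perm_tuple [tuple of v :: t] w) == s) (-1) ^+ w : int).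
  apply: eq_bigr => w _; rewrite (big_pred1 ((w^-1)%g ord0)).
    by rewrite [RHS]big_mkcond.
  by move=> i /=; rewrite -(inj_eq (@perm_inj _ (w^-1)%g)) permK.
rewrite (exchange_big_dep xpredT) //=; apply: eq_bigr => i _.
rewrite ffunMzE ffunE mulrzz mulr_suml.
pose h (u : 'S_p.+1) : 'S_p.+2 := lift_perm i ord0 u.
rewrite (reindex h); last first.
  pose f (w : 'S_p.+2) k := odflt ord0 (unlift (w i) (w (lift i k))).
  have fK (w : 'S_p.+2) k : lift (w i) (f w k) = w (lift i k).
    rewrite /f; have := neq_lift i k.
    by rewrite -(can_eq (permK w)) => /unlift_some[] ? ? ->.
  have f_inj (w : 'S_p.+2) : injective (f w).
    by move=> j k jk; apply: (@lift_inj _ i); apply: (@perm_inj _ w);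
       rewrite -!fK jk.
  exists (fun w => perm (@f_inj w)) => [u _ | w].
    by apply/permP=> k; rewrite permE /f lift_perm_lift lift_perm_id liftK.
  move/(_ =P _) => wi; apply/permP=> k; rewrite /h.
  have [j ->|->] := unliftP i k; rewrite ?lift_perm_id //.
  by rewrite lift_perm_lift -wi permE fK.
rewrite big_mkcond [RHS]big_mkcond; apply: eq_bigr => u _.
rewrite lift_perm_id eqxx odd_lift_perm addbF.
set r := rem _ _.
have rE : r = take i s ++ drop i.+1 s.
  by rewrite /r remE index_uniq // ss.
have szr : size r = p.+1.
  by rewrite rE size_cat size_takel ?size_drop ss; have := ltn_ord i; lia.
have nthr j : nth x0 r j = nth x0 s (bump i j).
  rewrite rE nth_cat size_takel; last by rewrite ss; have := ltn_ord i; lia.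
  rewrite /bump; case: leqP => ij; last by rewrite nth_take.
  by rewrite nth_drop; congr nth; lia.
have key v : (tval (perm_tuple [tuple of v :: t] (h u)) == s)
           = (v == nth x0 s i) && (tval (perm_tuple t u) == r).
  have hi : nth x0 (perm_tuple [tuple of v :: t] (h u)) i = v.
    by rewrite -tnth_nth tnth_mktuple lift_perm_id tnth0.
  have hl (j : 'I_p.+1) : nth x0 (perm_tuple [tuple of v :: t] (h u)) (bump i j)
      = nth x0 (perm_tuple t u) j.
    rewrite -[bump i j]/(val (lift i j)) -!tnth_nth.
    by rewrite !tnth_mktuple lift_perm_lift tnthS.
  apply/eqP/andP => [E|[/eqP vE /eqP tE]].
    split; first by rewrite -E hi.
    apply/eqP/(@eq_from_nth _ x0); rewrite ?size_tuple // => j jp.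
    by rewrite nthr -E -[j]/(val (Ordinal jp)) hl.
  apply/(@eq_from_nth _ x0); rewrite ?size_tuple // => j jp.
  have [k jE|jE] := unliftP i (Ordinal jp); rewrite -[j]/(val (Ordinal jp)) jE.
    by rewrite -[val _]/(bump i k) hl tE nthr.
  by rewrite hi.
under eq_bigl do rewrite key.
have [tE|tE] := boolP (tval (perm_tuple t u) == r).
  rewrite (big_pred1 (nth x0 s i)) => [|v]; last by rewrite /= andbT.
  by rewrite signr_addb signr_odd mulrC.
by rewrite big_pred0 // => v; rewrite andbF.
Qed.

End ChainTheory.

Section PushTheory.
Variables (V W : finType) (K : complex V) (L : complex W) (f : V -> W).

Lemma pushB p : {morph push f (p:=p) : a b / a - b}.
Proof.
move=> a b; apply/ffunP => t; rewrite !ffunE -sumrB.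
by apply: eq_bigr => s _; rewrite !ffunE.
Qed.

Lemma map_perm_tuple p (t : p.+1.-tuple V) (s : 'S_p.+1) :
  map_tuple f (perm_tuple t s) = perm_tuple (map_tuple f t) s.
Proof. by apply: eq_from_tnth => i; rewrite tnth_map !tnth_mktuple tnth_map. Qed.

Lemma push_alt p (c : coefs V p) :
  (forall t s, c (perm_tuple t s) = (-1) ^+ s * c t) ->
  forall t s, push f c (perm_tuple t s) = (-1) ^+ s * push f c t.
Proof.
move=> cA t s; rewrite !ffunE mulr_sumr.
rewrite (reindex_inj (can_inj (perm_tupleK s))).
apply: eq_big => [u|u _]; last exact: cA.
by rewrite map_perm_tuple (can_eq (perm_tupleK s)).
Qed.

Lemma push_chain p (c : coefs V p) : simplicial K L f ->
  c \in chains K (p:=p) -> push f c \in chains L (p:=p).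
Proof.
move=> sf /chainsP[cK cA]; have pA := push_alt cA.
apply/chainsP; split=> // t ct; split.
  apply: contraNT ct => /(uniqPn (thead t))[i [j [ij jt tij]]].
  rewrite size_tuple in jt; pose i' := Ordinal (ltn_trans ij jt).
  pose j' := Ordinal jt; have nij : i' != j' by rewrite -val_eqE /= ltn_eqF.
  have tij' : tnth t i' = tnth t j' by rewrite !(tnth_nth (thead t)).
  have := pA t (tperm i' j'); rewrite odd_tperm nij mulN1r.
  have -> : perm_tuple t (tperm i' j') = t.
    apply: eq_from_tnth => k; rewrite tnth_mktuple.
    by case: tpermP => [->|->|].
  by move=> E; apply/eqP; lia.
have [s /andP[/eqP <- cs]] : exists s, (map_tuple f s == t) && (c s != 0).
  apply/existsP; apply: contraNT ct => /existsPn no.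
  rewrite ffunE big1 // => s fs; apply/eqP.
  by have := no s; rewrite fs /= negbK.
have [_ /sf] := cK _ cs; suff -> : f @: [set x in s] = [set x in map_tuple f s].
  by [].
apply/setP => y; rewrite inE; apply/imsetP/mapP.
  by case=> x; rewrite inE => xs ->; exists x.
by case=> x xs ->; exists x; rewrite ?inE.
Qed.

Lemma bd_push p (c : coefs V p.+1) : bd (push f c) = push f (bd c).
Proof.
apply/ffunP => t; rewrite !ffunE.
under eq_bigr do rewrite ffunE big_mkcond.
under [RHS]eq_bigr do rewrite ffunE.
rewrite exchange_big /=.
transitivity (\sum_(s : p.+2.-tuple V | map_tuple f (behead_tuple s) == t) c s).
  rewrite [RHS]big_mkcond; apply: eq_bigr => s _; rewrite -big_mkcond.
  case/tupleP: s => u s.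
  have E v : (map_tuple f [tuple of u :: s] == [tuple of v :: t])
     = (v == f u) && (map_tuple f s == t).
    by rewrite -!val_eqE /= eqseq_cons [v == _]eq_sym.
  have -> : behead_tuple [tuple of u :: s] = s by apply: val_inj.
  under eq_bigl do rewrite E.
  have [st|st] := boolP (map_tuple f s == t).
    by rewrite (big_pred1 (f u)) // => v; rewrite /= andbT.
  by rewrite big_pred0 // => v; rewrite andbF.
rewrite pair_big_dep.
rewrite (reindex (fun u : p.+1.-tuple V * V => [tuple of u.2 :: u.1])) /=.
  apply: eq_bigl => -[s v] /=; rewrite andbT; congr (map_tuple f _ == t).
  exact: val_inj.
exists (fun s : p.+2.-tuple V => (behead_tuple s, thead s)) => [[s v] _|s _] /=.
  by congr pair; apply: val_inj.
by rewrite [RHS]tuple_eta; apply: val_inj.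
Qed.

Lemma push_osimplex p (s : seq V) :
  push f (osimplex p s) = osimplex p (map f s).
Proof.
apply/ffunP => t; rewrite !ffunE.
under eq_bigr do rewrite ffunE.
rewrite (exchange_big_dep xpredT) //= [RHS]big_mkcond; apply: eq_bigr => u _.
have [ss|ss] := eqVneq (size s) p.+1; last first.
  rewrite big_pred0 => [|v]; last first.
    apply/negP => /andP[_ /eqP sE]; case/eqP: ss; rewrite -sE.
    exact: (size_tuple (perm_tuple v u)).
  case: eqP => // tE; case/eqP: ss; rewrite -(size_map f) -tE.
  exact: (size_tuple (perm_tuple t u)).
pose s' := perm_tuple (Tuple (introT eqP ss)) u^-1.
have E r : (tval (perm_tuple r u) == s) = (r == s').
  apply/eqP/eqP => [rs|->]; last by rewrite /s' perm_tupleM mulgV perm_tuple1.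
  rewrite /s'; have -> : Tuple (introT eqP ss) = perm_tuple r u by exact: val_inj.
  by rewrite perm_tupleM mulVg perm_tuple1.
under eq_bigl do rewrite E.
have E' : (tval (perm_tuple t u) == map f s) = (map_tuple f s' == t).
  have fs : map f s = tval (map_tuple f (Tuple (introT eqP ss))) by [].
  rewrite fs /s' map_perm_tuple; apply/eqP/eqP => [/val_inj <-|<-].
    by rewrite perm_tupleM mulVg perm_tuple1.
  by rewrite perm_tupleM mulgV perm_tuple1.
rewrite E'; case: eqP => st; last first.
  by rewrite big_pred0 // => r; apply/negP => /andP[/eqP rt /eqP rs]; subst.
rewrite (big_pred1 s') // => r /=.
by case: (r =P s') => [->|_]; rewrite ?andbF ?andbT ?st ?eqxx.
Qed.

Lemma push_comp (U : finType) (h : U -> V) p (c : coefs U p) :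
  push f (push h c) = push (f \o h) c.
Proof.
apply/ffunP => t; rewrite !ffunE; under eq_bigr do rewrite ffunE.
rewrite (exchange_big_dep xpredT) //= [RHS]big_mkcond; apply: eq_bigr => u _.
have -> : map_tuple (f \o h) u = map_tuple f (map_tuple h u).
  by apply: val_inj; rewrite /= map_comp.
case: eqP => ut; last first.
  by rewrite big_pred0 // => r; apply/negP => /andP[/eqP rt /eqP ur]; case: ut; rewrite ur.
rewrite (big_pred1 (map_tuple h u)) // => r /=; rewrite [_ == r]eq_sym.
by case: (r =P _) => [->|]; rewrite ?andbF ?ut ?eqxx.
Qed.

Lemma push_cycle p (c : coefs V p) : simplicial K L f ->
  c \in cycles K (p:=p) -> push f c \in cycles L (p:=p).
Proof.
move=> sf /andP[cK bc]; apply/andP; split; first exact: (push_chain sf).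
case: p c cK bc => //= p c _ /eqP bc.
by rewrite bd_push bc -(subrr 0) pushB subrr.
Qed.

End PushTheory.

Lemma eq_push (V W : finType) (f g : V -> W) p (c : coefs V p) :
  f =1 g -> push f c = push g c.
Proof.
move=> fg; apply/ffunP => t; rewrite !ffunE; apply: eq_bigl => u.
by congr (_ == t); apply: val_inj; apply: eq_map.
Qed.

Lemma push_id (V : finType) p (c : coefs V p) : push id c = c.
Proof.
apply/ffunP => t; rewrite ffunE (big_pred1 t) // => u /=; congr (_ == t).
by apply: val_inj; rewrite /= map_id.
Qed.

Record cycle_of (V : finType) (K : complex V) (p : nat) := Cycle {
  cycle_val :> coefs V p;
  cycle_valP : cycle_val \in cycles K (p:=p)
}.

HB.instance Definition _ V K p := [isSub for @cycle_val V K p].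
HB.instance Definition _ V K p := [Choice of @cycle_of V K p by <:].
HB.instance Definition _ V K p :=
  [SubChoice_isSubZmodule of @cycle_of V K p by <:].

Definition boundaries (V : finType) (K : complex V) p : {pred cycle_of K p} :=
  fun z => `[< exists2 c, c \in chains K (p:=p.+1) & bd c = z >].

Lemma boundaries_closed (V : finType) (K : complex V) p :
  zmod_closed (boundaries (K:=K) (p:=p)).
Proof.
split=> [|a b /asboolP[c cK ca] /asboolP[d dK db]]; apply/asboolP.
  by exists 0; rewrite ?rpred0 // -(subrr 0) bdB subrr.
by exists (c - d); rewrite ?rpredB // bdB ca db.
Qed.

HB.instance Definition _ V K p :=
  GRing.isZmodClosed.Build (cycle_of K p) (@boundaries V K p)
    (@boundaries_closed V K p).

Definition homology (V : finType) (K : complex V) p : zmodType :=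
  Quotient.quot (boundaries (K:=K) (p:=p)).

Definition hclass (V : finType) (K : complex V) p (z : cycle_of K p) :
  homology K p := \pi_(Quotient.quot (boundaries (K:=K) (p:=p))) z.

Definition cycle_map (V W : finType) (K : complex V) (L : complex W)
  (f : V -> W) (sf : simplicial K L f) p (z : cycle_of K p) : cycle_of L p :=
  Cycle (push_cycle sf (cycle_valP z)).

Definition homology_map (V W : finType) (K : complex V) (L : complex W)
  (f : V -> W) (sf : simplicial K L f) p (a : homology K p) : homology L p :=
  hclass (cycle_map sf (generic_quotient.repr a)).

Lemma hclass_eq (V : finType) (K : complex V) p (y z : cycle_of K p) :
  hclass y = hclass z <->
  exists2 c, c \in chains K (p:=p.+1) & bd c = cycle_val y - cycle_val z.
Proof.
rewrite /hclass; split.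
  by move/eqP; rewrite -Quotient.idealrBE => /asboolP.
by move=> yz; apply/eqP; rewrite -Quotient.idealrBE; apply/asboolP.
Qed.

Lemma hclassK (V : finType) (K : complex V) p (a : homology K p) :
  hclass (generic_quotient.repr a) = a.
Proof. exact: reprK. Qed.

Lemma hclassMz (V : finType) (K : complex V) p (z : cycle_of K p) m :
  hclass (z *~ m) = hclass z *~ m.
Proof. exact: raddfMz. Qed.

Lemma homology_map_class (V W : finType) (K : complex V) (L : complex W)
  (f : V -> W) (sf : simplicial K L f) p (z : cycle_of K p) :
  homology_map sf (hclass z) = hclass (cycle_map sf z).
Proof.
have [c cK bc] : exists2 c, c \in chains K (p:=p.+1)
    & bd c = cycle_val (generic_quotient.repr (hclass z)) - cycle_val z.
  by apply/hclass_eq; rewrite hclassK.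
apply/hclass_eq; exists (push f c); first exact: (push_chain sf).
by rewrite bd_push bc pushB.
Qed.

Definition interval n (i j : int) : {set 'Z_n} :=
  [set (i + m%:Z)%:~R | m : 'I_(absz (j - i)%R).+1].

Definition Nfaces n k : {set {set 'Z_n}} :=
  [set A : {set 'Z_n} |
     [exists i : 'Z_n, A \subset interval n i%:Z (i%:Z + k%:Z)]].

Lemma Nfaces_sub n k (A B : {set 'Z_n}) :
  B \in Nfaces n k -> A \subset B -> A \in Nfaces n k.
Proof.
rewrite !inE => /existsP[i Bi] AB; apply/existsP; exists i.
exact: subset_trans Bi.
Qed.

(* The vertex set is 'Z_n, which is Z/n only for n > 1. *)
Definition N n k : complex 'Z_n := Complex (@Nfaces_sub n k).

Lemma card_interval n k (i : int) : (k < n)%N -> (1 < n)%N ->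
  #|interval n i (i + k%:Z)| = k.+1.
Proof.
move=> kn n1; have e : absz (i + k%:Z - i)%R = k by lia.
rewrite card_imset; first by rewrite card_ord e.
move=> a b /eqP; rewrite !intrD (inj_eq (addrI _)) -!pmulrn => /eqP/(congr1 val).
have lt m : (m < (absz (i + k%:Z - i)%R).+1)%N -> (m < n)%N by rewrite e; lia.
by rewrite /= !val_Zp_nat // !modn_small ?lt // => /val_inj.
Qed.

Lemma N_maximal n k (A : {set 'Z_n}) : (k < n)%N -> (1 < n)%N ->
  maxset (fun B => B \in N n k) A
  = [exists i : 'Z_n, A == interval n i%:Z (i%:Z + k%:Z)].
Proof.
move=> kn n1; apply/maxsetP/existsP.
  case; rewrite inE => /existsP[i Ai] Amax; exists i; apply/eqP.
  by rewrite (Amax _ _ Ai) // inE; apply/existsP; exists i.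
case=> i /eqP ->; split=> [|B]; first by rewrite inE; apply/existsP; exists i.
rewrite inE => /existsP[j Bj] iB; apply/eqP.
by rewrite eq_sym eqEcard iB card_interval // -(@card_interval n k j) ?subset_leq_card.
Qed.

Lemma in_N n k (A : {set 'Z_n}) :
  reflect (exists a : 'Z_n, forall x, x \in A ->
             exists2 m : nat, (m <= k)%N & x = a + m%:R)
          (A \in N n k).
Proof.
have iE (i : 'Z_n) (x : 'Z_n) : x \in interval n i%:Z (i%:Z + k%:Z) <->
    exists2 m : nat, (m <= k)%N & x = i + m%:R.
  have e : absz (i%:Z + k%:Z - i%:Z)%R = k by lia.
  have f m : (i%:Z + m%:Z)%:~R = i + m%:R :> 'Z_n.
    by rewrite -PoszD -pmulrn natrD natr_Zp.
  split=> [/imsetP[m _ ->]|[m mk ->]].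
    by exists m; rewrite ?f //; rewrite -ltnS (leq_trans (ltn_ord m)) ?e.
  have mlt : (m < (absz (i%:Z + k%:Z - i%:Z)%R).+1)%N by rewrite e.
  by apply/imsetP; exists (Ordinal mlt) => //; rewrite f.
rewrite inE; apply: (iffP existsP) => -[a H]; exists a.
  by move=> x /(subsetP H)/iE.
by apply/subsetP => x /H/iE.
Qed.

(* Dihedral a b stands for g^a eps^b. *)
Record dihedral n := Dihedral { rot : 'Z_n; flip : bool }.

Section Dihedral.
Variable n : nat.

Definition dihedral_pair (x : dihedral n) := (rot x, flip x).
Lemma dihedral_pairK :
  cancel dihedral_pair (fun u => Dihedral u.1 u.2).
Proof. by case. Qed.

HB.instance Definition _ := Finite.copy (dihedral n) (can_type dihedral_pairK).

Definition dmul (x y : dihedral n) :=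
  Dihedral (rot x + (if flip x then - rot y else rot y)) (flip x (+) flip y).
Definition did : dihedral n := Dihedral 0 false.
Definition dinv (x : dihedral n) :=
  Dihedral (if flip x then rot x else - rot x) (flip x).

Lemma dmulA : associative dmul.
Proof.
by move=> [a [] ] [b [] ] [c [] ]; congr Dihedral => /=; rewrite ?opprD ?opprK addrA.
Qed.
Lemma dmul1 : left_id did dmul.
Proof. by case=> a b; rewrite /dmul /= add0r. Qed.
Lemma dmulV : left_inverse did dinv dmul.
Proof. by case=> a []; congr Dihedral; rewrite /= ?subrr ?addNr. Qed.

HB.instance Definition _ := Finite_isGroup.Build (dihedral n) dmulA dmul1 dmulV.

Definition dg : dihedral n := Dihedral 1 false.
Definition deps : dihedral n := Dihedral 0 true.

Definition dact (x : dihedral n) (i : 'Z_n) : 'Z_n :=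
  rot x + (if flip x then - i else i).

Lemma dact1 i : dact 1%g i = i.
Proof. exact: add0r. Qed.

Lemma dactM x y i : dact (x * y)%g i = dact x (dact y i).
Proof.
by case: x y => [a [] ] [b [] ]; rewrite /dact /= ?opprD ?opprK addrA.
Qed.

Lemma dact_g i : dact dg i = i + 1.
Proof. exact: addrC. Qed.

Lemma dact_eps i : dact deps i = - i.
Proof. exact: add0r. Qed.

Lemma dg_exp m : (dg ^+ m)%g = Dihedral m%:R false.
Proof.
elim: m => [|m IH] //; rewrite expgS IH; congr Dihedral.
by rewrite /= -natr1 addrC.
Qed.

Lemma dihedral_rels : (1 < n)%N ->
  [/\ dg ^+ n = 1, deps ^+ 2 = 1 & deps * dg * deps = dg^-1]%g.
Proof.
move=> n1; split; first by rewrite dg_exp; congr Dihedral; rewrite pchar_Zp.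
  by congr Dihedral; rewrite /= oppr0 addr0.
by congr Dihedral; rewrite /= add0r oppr0 addr0.
Qed.

Lemma dihedral_isog : (1 < n)%N -> [set: dihedral n] \isog 'D_(n.*2).
Proof.
move=> n1; have ggen x : x \in <<[set dg; deps]>>%g.
  have -> : x = (dg ^+ rot x * deps ^+ flip x)%g.
    rewrite dg_exp natr_Zp; case: x => a [] /=.
      by congr Dihedral; rewrite addr0.
    by congr Dihedral; rewrite addr0.
  by rewrite groupM // groupX // mem_gen // !inE eqxx ?orbT.
rewrite isogEcard card_dihedral // cardsT; apply/andP; split; last first.
  have f_bij : bijective dihedral_pair.
    exists (fun u => Dihedral u.1 u.2); first exact: dihedral_pairK.
    by case.
  by rewrite (bij_eq_card f_bij) card_prod card_bool card_ord Zp_cast // muln2.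
rewrite Grp_dihedral //; apply/existsP; exists (dg, deps); rewrite /= !xpair_eqE.
apply/and4P; split.
- by apply/eqP/setP => x; rewrite inE; have := ggen x; rewrite /= joing_idl joing_idr.
- by rewrite dg_exp; apply/eqP; congr Dihedral; rewrite pchar_Zp.
- by apply/eqP; congr Dihedral; rewrite /= oppr0 addr0.
- by apply/eqP; congr Dihedral; rewrite /= ?add0r ?addr0.
Qed.

Lemma dact_simplicial k x : simplicial (N n k) (N n k) (dact x).
Proof.
move=> A /in_N[a Aa]; apply/in_N.
exists (rot x + if flip x then - a - k%:R else a) => _ /imsetP[y /Aa[m mk ->] ->].
rewrite /dact; case: (flip x); last by exists m; rewrite // addrA.
exists (k - m)%N; first exact: leq_subr.
by rewrite natrB // -addrA; congr (_ + _); rewrite opprD addrA subrK.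
Qed.

End Dihedral.

Definition haction n k p (x : dihedral n) (a : homology (N n k) p) :
  homology (N n k) p := homology_map (@dact_simplicial n k x) a.

Lemma haction1 n k p (a : homology (N n k) p) : haction 1%g a = a.
Proof.
rewrite -[a]hclassK /haction homology_map_class; congr hclass; apply: val_inj.
by rewrite /= (eq_push _ (@dact1 n)) push_id.
Qed.

Lemma hactionM n k p (x y : dihedral n) (a : homology (N n k) p) :
  haction (x * y)%g a = haction x (haction y a).
Proof.
rewrite -[a]hclassK /haction !homology_map_class; congr hclass; apply: val_inj.
by rewrite /= push_comp; apply: eq_push => i; apply: dactM.
Qed.

Lemma hactionB n k p (x : dihedral n) :
  {morph @haction n k p x : a b / a - b}.
Proof.
move=> a b; rewrite -[a]hclassK -[b]hclassK.
have hB (y z : cycle_of (N n k) p) : hclass (y - z) = hclass y - hclass z.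
  exact: raddfB.
rewrite -hB /haction !homology_map_class -hB; congr hclass; apply: val_inj.
exact: pushB.
Qed.

Definition zpow (gT : finGroupType) (x : gT) (m : int) : gT :=
  match m with Posz j => (x ^+ j)%g | Negz j => (x ^- j.+1)%g end.

Definition Delta n k l : seq 'Z_n :=
  flatten [seq [:: (i * (n - k))%:R; (i * (n - k) + 1)%:R] | i <- iota 0 l.+1].

Definition dDelta n k l : coefs 'Z_n l.*2 :=
  \sum_(i < l.+1) (osimplex l.*2 (rem (i * (n - k))%:R (Delta n k l))
                 - osimplex l.*2 (rem (i * (n - k) + 1)%:R (Delta n k l))).

Section DeltaTheory.
Variables n k l : nat.
Hypothesis hk : (k + 2 <= n)%N.
Hypothesis hl : k%:R / n%:R = l%:R / l.+1%:R :> rat.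

Lemma ratio_nat : (l * (n - k) = k)%N.
Proof.
have n0 : n%:R != 0 :> rat by rewrite pnatr_eq0; lia.
have l0 : l.+1%:R != 0 :> rat by rewrite pnatr_eq0.
move/eqP: hl; rewrite eqr_div // -!natrM eqr_nat => /eqP E.
by rewrite mulnBr -E; lia.
Qed.

Let d := (n - k)%N.
Let d1 : (1 < d)%N. Proof. by rewrite /d; lia. Qed.
Let nE : n = (l.+1 * d)%N.
Proof. by rewrite mulSn ratio_nat /d; lia. Qed.
Let n1 : (1 < n)%N. Proof. by lia. Qed.

Let nR : n%:R = 0 :> 'Z_n.
Proof. by rewrite pchar_Zp. Qed.

Let vtx j := (j./2 * d + odd j)%N.

Lemma DeltaE : Delta n k l = [seq (vtx j)%:R | j <- iota 0 (l.+1).*2].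
Proof.
rewrite /Delta -/d; elim: l.+1 => // m IH.
have -> : iota 0 m.+1 = iota 0 m ++ [:: m] by rewrite -{1}(addn1 m) iotaD.
have -> : iota 0 m.+1.*2 = iota 0 m.*2 ++ [:: m.*2; m.*2.+1].
  by rewrite doubleS -{1}(addn2 m.*2) iotaD.
rewrite !map_cat flatten_cat IH /= /vtx /= odd_double.
by rewrite uphalf_double doubleK addn0.
Qed.

Lemma size_Delta : size (Delta n k l) = l.*2.+2.
Proof. by rewrite DeltaE size_map size_iota doubleS. Qed.

Let vtx_lt j : (j < (l.+1).*2)%N -> (vtx j < n)%N.
Proof.
move=> jl; rewrite nE /vtx.
have : (j./2.+1 * d <= l.+1 * d)%N by rewrite leq_mul2r ltn_half_double jl orbT.
rewrite (mulSn j./2); apply: leq_trans; rewrite addnC ltn_add2r.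
by apply: leq_ltn_trans d1; case: odd.
Qed.

Lemma Delta_uniq : uniq (Delta n k l).
Proof.
rewrite DeltaE map_inj_in_uniq ?iota_uniq // => i j.
rewrite !mem_iota !add0n => /andP[_ il] /andP[_ jl] /(congr1 val).
rewrite /= !val_Zp_nat // !modn_small ?vtx_lt // => E.
have odd_lt m : (odd m < d)%N by apply: leq_ltn_trans d1; case: odd.
have dv m : (vtx m %/ d)%N = m./2.
  by rewrite divnMDl ?(ltnW d1) // divn_small ?addn0 ?odd_lt.
have md m : (vtx m %% d)%N = odd m.
  by rewrite modnMDl modn_small ?odd_lt.
have h2 : i./2 = j./2 by rewrite -dv E dv.
have ho : odd i = odd j :> nat by rewrite -md E md.
by rewrite -[i]odd_double_half -[j]odd_double_half h2 ho.
Qed.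

Lemma nth_Delta j : (j < l.*2.+2)%N -> nth 0 (Delta n k l) j = (vtx j)%:R.
Proof.
by move=> jl; rewrite DeltaE (nth_map 0%N) ?size_iota ?nth_iota ?add0n ?doubleS.
Qed.

Lemma dDeltaE : dDelta n k l = bd (osimplex l.*2.+1 (Delta n k l)).
Proof.
rewrite (bd_osimplex 0 Delta_uniq size_Delta).
have pair (F : nat -> coefs 'Z_n l.*2) m :
    \sum_(i < m.*2) F i = \sum_(i < m) (F i.*2 + F i.*2.+1).
  elim: m => [|m IH]; first by rewrite !big_ord0.
  by rewrite doubleS 2!big_ord_recr big_ord_recr /= IH addrA.
rewrite (pair (fun i => osimplex l.*2 (rem (nth 0 (Delta n k l) i)
                          (Delta n k l)) *~ (-1) ^+ i) l.+1).
apply: eq_bigr => i _; have := ltn_ord i => il.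
have E2 : (-1) ^+ i.*2 = 1 :> int by rewrite -signr_odd odd_double.
rewrite exprS E2 mulr1 mulrNz mulr1z !nth_Delta ?doubleS; try by lia.
by rewrite /vtx /= odd_double uphalf_double doubleK addn0.
Qed.

Lemma Delta_face j : (j < l.*2.+2)%N ->
  [set x in rem (vtx j)%:R (Delta n k l)] \in N n k.
Proof.
move=> jl; pose i := j./2; apply/in_N.
have kE : k = (l * d)%N by rewrite ratio_nat.
have il : (i <= l)%N by rewrite /i -ltnS ltn_half_double doubleS.
have Dx x : x \in [set x in rem (vtx j)%:R (Delta n k l)] ->
    exists p e : nat, [/\ (p <= l)%N, (e <= 1)%N, x = (p * d + e)%:R
      & (p, e) <> (i, nat_of_bool (odd j))].
  rewrite inE (mem_rem_uniq _ Delta_uniq) inE => /andP[xj].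
  rewrite {1}DeltaE => /mapP[m]; rewrite mem_iota add0n => /andP[_ ml] xE.
  exists m./2, (odd m); split=> //; first by rewrite -ltnS ltn_half_double.
    by case: odd.
  by move=> [h1 h2]; case/eqP: xj; rewrite xE /vtx h1 h2.
have eqn (a b : nat) : a = b \/ (a + n)%N = b -> a%:R = b%:R :> 'Z_n.
  by case=> <- //; rewrite natrD nR addr0.
case jo: (odd j) Dx => /= Dx.
- exists (i * d + d)%:R => x /Dx[p [e [pl e1 -> pe]]].
  have [ip|ip|ip] := ltngtP i p.
  + exists ((p - i.+1) * d + e)%N; last first.
      rewrite -natrD; apply: eqn; left.
      by rewrite addnA -mulSnr -mulnDl subnKC.
    rewrite kE; have : ((p - i.+1).+1 * d <= l * d)%N by rewrite leq_mul2r; lia.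
    by rewrite mulSn; lia.
  + exists ((p + l - i) * d + e)%N; last first.
      rewrite -natrD; apply: eqn; right.
      rewrite nE addnAC -mulnDl addnA -mulSnr -mulnDl; congr (_ * _ + _)%N; lia.
    rewrite kE; have : ((p + l - i).+1 * d <= l * d)%N by rewrite leq_mul2r; lia.
    by rewrite mulSn; lia.
  + have e0 : e = 0%N by case: e e1 pe => [|[|//]] // _; rewrite ip.
    exists k => //; rewrite -natrD; apply: eqn; right.
    by rewrite e0 ip kE nE mulSn; lia.
- exists (i * d + 1)%:R => x /Dx[p [e [pl e1 -> pe]]].
  have [ip|ip|ip] := ltngtP i p.
  + exists ((p - i) * d + e - 1)%N; last first.
      rewrite -natrD; apply: eqn; left.
      have : (d <= (p - i) * d)%N by rewrite leq_pmull // subn_gt0.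
      have : (p * d = i * d + (p - i) * d)%N by rewrite -mulnDl subnKC // ltnW.
      by lia.
    rewrite kE; have : ((p - i) * d <= l * d)%N by rewrite leq_mul2r; lia.
    by lia.
  + exists ((p + l.+1 - i) * d + e - 1)%N; last first.
      rewrite -natrD; apply: eqn; right.
      have : (d <= (p + l.+1 - i) * d)%N by rewrite leq_pmull // subn_gt0; lia.
      have : (p * d + n = i * d + (p + l.+1 - i) * d)%N.
        by rewrite nE -!mulnDl; congr (_ * _)%N; lia.
      by lia.
    rewrite kE; have : ((p + l.+1 - i) * d <= l * d)%N by rewrite leq_mul2r; lia.
    by lia.
  + have e0 : e = 1%N by case: e e1 pe => [|[|//]] // _; rewrite ip.
    by exists 0%N => //; rewrite addr0 e0 ip.
Qed.

Lemma dDelta_cycle : dDelta n k l \in cycles (N n k) (p:=l.*2).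
Proof.
have dc : dDelta n k l \in chains (N n k) (p:=l.*2).
  apply: rpred_sum => i _; apply: rpredB; apply: osimplex_chain;
    rewrite ?rem_uniq ?Delta_uniq //.
    have := @Delta_face i.*2; rewrite /vtx odd_double doubleK addn0.
    by apply; have := ltn_ord i; lia.
  have := @Delta_face i.*2.+1; rewrite /vtx /= odd_double uphalf_double /=.
  by apply; have := ltn_ord i; lia.
by rewrite dDeltaE in dc *; apply: bd_cycle => //; exact: osimplex_alt.
Qed.

End DeltaTheory.

Definition alpha n k l (hk : (k + 2 <= n)%N)
  (hl : k%:R / n%:R = l%:R / l.+1%:R :> rat) (i : int) :
  homology (N n k) l.*2 :=
  hclass (cycle_map (@dact_simplicial n k (zpow (dg n) i))
                    (Cycle (dDelta_cycle hk hl))).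

(* Main.v *)
Require Import Defs.
From HB Require Import structures.
From mathcomp Require Import all_boot all_order all_algebra all_fingroup.
From mathcomp Require Import zify.

Set Implicit Arguments.
Unset Strict Implicit.
Unset Printing Implicit Defensive.

Import GRing.Theory.
Local Open Scope ring_scope.

(** Both formulas already hold for chains. Rotations commute with each other,
    so g sends the chain of alpha_i to that of alpha_(i+1). For eps, put
    d = n - k, so that n = (l+1)d and d >= 2, and write
      eps (x + i) = (1 - x) + (- i - 1),
    that is, eps g^i = g^(-i-1) r with r the reflection x |-> 1 - x. Modulo n,
    r exchanges the vertices jd and (l+1-j)d + 1 of Delta, so it preserves the
    vertex set of Delta; it fixes no vertex, since 2jd = 1 or 2jd + 1 = 0
    modulo n would make d divide 1. Hence r permutes the 2l+2 vertices as a
    product of l+1 disjoint transpositions, and r Delta = (-1)^(l+1) Delta as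
    oriented simplices ([osimplex_fpf_involution]). Pushing forward commutes
    with the boundary, so the same sign relates r(bd Delta) and bd Delta
    ([push_reflection_dDelta]); applying g^(-i-1) gives the second formula. *)

Lemma porbit_involution (T : finType) (u : {perm T}) (x : T) :
  involutive u -> porbit u x = [set x; u x].
Proof.
move=> uK; have u2 : (u ^+ 2)%g = 1%g.
  by apply/permP => y; rewrite permX perm1 /= uK.
apply/setP => y; rewrite !inE; apply/porbitP/orP => [[m ->]|[]/eqP ->].
- rewrite -(odd_double_half m) expgD -muln2 mulnC expgM u2 expg1n mulg1.
  by case: odd; [right | left]; rewrite ?expg1 ?expg0 ?perm1 eqxx.
- by exists 0%N; rewrite expg0 perm1.
- by exists 1%N; rewrite expg1.
Qed.

(** Such a permutation is a product of #|T|./2 disjoint transpositions: its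
    orbits are pairs, and the parity of a permutation is read off the numbers
    of points and of orbits. *)
Lemma odd_perm_fpf_involution (T : finType) (u : {perm T}) :
  involutive u -> (forall x, u x != x) -> odd_perm u = odd #|T|./2.
Proof.
move=> uK ufix.
have cT : #|T| = (#|porbits u| * 2)%N.
  rewrite -cardsT; apply: card_uniform_partition => [_ /imsetP[x _ ->]|].
    by rewrite porbit_involution // cards2 eq_sym ufix.
  have -> : porbits u = orbit 'P <[u]>%g @: [set: T].
    apply/setP => A; rewrite -porbitE.
    by apply/imsetP/imsetP => -[x _ ->]; exists x; rewrite ?inE.
  apply: orbit_partition; apply/subsetP => a _.
  by rewrite !inE; apply/subsetP => x; rewrite !inE.
by rewrite /odd_perm cT muln2 doubleK odd_double.
Qed.

Section OrientedSimplices.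
Variable V : finType.

HB.instance Definition _ p :=
  GRing.isZmodMorphism.Build (coefs V p.+1) (coefs V p) (@bd V p) (@bdB V p).

Lemma osimplex_perm p (t : p.+1.-tuple V) (u : 'S_p.+1) :
  osimplex p (perm_tuple t u) = osimplex p t *~ (-1) ^+ u.
Proof.
apply/ffunP => t'; rewrite ffunMzE !ffunE mulrzz mulr_suml.
rewrite (reindex_inj (mulgI u)).
apply: eq_big => [w|w _]; last by rewrite odd_permM signr_addb mulrC.
by rewrite -perm_tupleM !val_eqE (can_eq (perm_tupleK u)).
Qed.

(** The number of vertices is even, and r swaps them in (p+1)/2 pairs, each of
    which contributes a sign. *)
Lemma osimplex_fpf_involution p (s : seq V) (r : V -> V) :
    uniq s -> size s = p.+1 -> involutive r ->
    {in s, forall x, r x \in s} -> {in s, forall x, r x != x} ->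
  osimplex p (map r s) = osimplex p s *~ (-1) ^+ (p.+1)./2.
Proof.
move=> su ss rK rs rfix; pose t := Tuple (introT eqP ss).
have st : s = t by [].
have /tuple_permP[u rE] : perm_eq (map r t) t.
  apply: uniq_perm => //; first by rewrite map_inj_uniq //; apply: inv_inj.
  move=> x; apply/mapP/idP => [[y ys ->]|xs]; first exact: rs.
  by exists (r x); rewrite ?rK ?rs.
have tu j : tnth t (u j) = r (tnth t j).
  have rtE : map_tuple r t = perm_tuple t u by exact: val_inj.
  by have := congr1 (@tnth _ _ ^~ j) rtE; rewrite /= tnth_map tnth_mktuple.
have tI : injective (tnth t) by apply/tuple_uniqP.
have uK : involutive u by move=> j; apply: tI; rewrite !tu rK.
have ufix j : u j != j by rewrite -(inj_eq tI) tu rfix // st mem_tnth.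
rewrite [in LHS]st [map r t]rE (osimplex_perm _ u).
by rewrite odd_perm_fpf_involution // card_ord signr_odd.
Qed.

End OrientedSimplices.

HB.instance Definition _ (V W : finType) (f : V -> W) p :=
  GRing.isZmodMorphism.Build (coefs V p) (coefs W p) (@push V W f p)
    (@pushB V W f p).

Lemma dact_zpow n (m : int) (x : 'Z_n) : dact (zpow (dg n) m) x = x + m%:~R.
Proof.
by case: m => m; rewrite /zpow dg_exp /dact /= addrC ?NegzE ?mulrNz.
Qed.

Section Reflection.
Variables n k l : nat.
Hypothesis hk : (k + 2 <= n)%N.
Hypothesis hl : k%:R / n%:R = l%:R / l.+1%:R :> rat.

Let d := (n - k)%N.
Let r (x : 'Z_n) : 'Z_n := 1 - x.

Let d_gt1 : (1 < d)%N. Proof. rewrite /d; lia. Qed.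

Let nE : n = (l.+1 * d)%N.
Proof. by have := ratio_nat hk hl; rewrite mulSn /d; lia. Qed.

Let natr_eq0 m : (m%:R == 0 :> 'Z_n) = (n %| m)%N.
Proof.
have n1 : (1 < n)%N by lia.
by rewrite -(inj_eq val_inj) /= val_Zp_nat.
Qed.

Lemma mem_Delta x : reflect
  (exists2 j, (j <= l)%N & x = (j * d)%:R \/ x = (j * d)%:R + 1)
  (x \in Delta n k l).
Proof.
apply: (iffP flatten_mapP) => [[j]|[j jl xj]].
  rewrite mem_iota !inE => jl /orP[]/eqP ->; exists j; rewrite ?natrD; tauto.
exists j; first by rewrite mem_iota.
by rewrite !inE natrD; case: xj => ->; rewrite eqxx ?orbT.
Qed.

(** The multiples of d form a subgroup of Z/n, because d divides n. *)
Lemma opposite_multiple j : (j <= l)%N ->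
  exists2 j', (j' <= l)%N & - (j * d)%:R = (j' * d)%:R :> 'Z_n.
Proof.
case: j => [_|j jl]; first by exists 0%N; rewrite ?oppr0.
exists (l - j)%N; first exact: leq_subr.
apply/eqP; rewrite eq_sym -addr_eq0 -natrD natr_eq0 -mulnDl.
by rewrite addnS subnK ?(ltnW jl) // -nE.
Qed.

Lemma reflection_Delta : {in Delta n k l, forall x, r x \in Delta n k l}.
Proof.
move=> x /mem_Delta[j /opposite_multiple[j' jl jE] xj].
apply/mem_Delta; exists j' => //; rewrite /r -jE.
by case: xj => ->; [right | left]; rewrite ?opprD addrC ?addrK ?subrK.
Qed.

Lemma reflection_Delta_fpf : {in Delta n k l, forall x, r x != x}.
Proof.
move=> x /mem_Delta[j jl xj]; apply/eqP => rx.
(* A fixed vertex x = jd is also 1 - x = j'd + 1, so one form suffices. *)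
have {j jl xj} [j xj] : exists j, x = (j * d)%:R + 1.
  case: xj => xj; last by exists j.
  have [j' _ jE] := opposite_multiple jl; exists j'.
  by rewrite -rx /r xj jE addrC.
have : (n %| (j * d).*2.+1)%N.
  (* jd + jd + 1 = x + jd = (1 - x) + jd = 0 modulo n. *)
  rewrite -natr_eq0 -natr1 -addnn natrD addrAC -xj -[in X in X + _]rx.
  by rewrite /r xj opprD addrCA subrr addr0 addNr.
have d_n : (d %| n)%N by rewrite nE dvdn_mull.
move/(dvdn_trans d_n); rewrite -addn1 -muln2 dvdn_addr.
  by rewrite dvdn1; move: d_gt1; case: d => [|[]].
by rewrite dvdn_mulr ?dvdn_mull.
Qed.

(** The sign is computed on Delta rather than on its faces: r permutes the
    faces of Delta among themselves without preserving any of them. *)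
Lemma push_reflection_dDelta :
  push r (dDelta n k l) = dDelta n k l *~ (-1) ^+ l.+1.
Proof.
rewrite (dDeltaE hk hl) -bd_push push_osimplex.
rewrite (osimplex_fpf_involution (Delta_uniq hk hl) (size_Delta n k l)).
- by rewrite raddfMz (_ : (_.+2)./2 = l.+1) //= doubleK.
- by move=> x; rewrite /r opprB addrC subrK.
- exact: reflection_Delta.
- exact: reflection_Delta_fpf.
Qed.

End Reflection.

Theorem proposition7p2 (n k l : nat) (hk : (k + 2 <= n)%N)
  (hl : k%:R / n%:R = l%:R / l.+1%:R :> rat) (i : int) :
  haction (dg n) (alpha hk hl i) = alpha hk hl (i + 1) /\
  haction (deps n) (alpha hk hl i) = alpha hk hl (- i - 1) *~ (-1) ^+ l.+1.
Proof.
rewrite /alpha /haction !homology_map_class -hclassMz; split; congr hclass.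
  apply: val_inj; rewrite /= push_comp; apply: eq_push => x /=.
  by rewrite dact_g !dact_zpow intrD addrA.
apply: val_inj; rewrite raddfMz /= push_comp -raddfMz /=.
(* This absorbs the sign into r, leaving eps g^i = g^(-i-1) r on vertices. *)
rewrite -(push_reflection_dDelta hk hl) push_comp; apply: eq_push => x /=.
rewrite dact_eps !dact_zpow opprD intrD !mulrNz mulr1z.
by rewrite [1 - x]addrC addrACA subrr addr0.
Qed.
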